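(* Let $n\ge 1$ and let $\Delta^t_n$ be the shifted trapezoidal diagram with rows of lengths $(2n+1,2n-1,\ldots,3,1)$, namely the set of cells $(r,c)$ with $1\le r\le n+1$ and $r\le c\le 2n+2-r$. The average, over all standard tableaux $t$ of shape $\Delta^t_n$, of the number of braid hooks of $t$ equals $1/2$.
   Context: Cells $(r,c)$ are indexed by row $r$ (top to bottom) and column $c$ (left to right). A standard tableau of a diagram with $N$ cells is a bijective filling of the cells with $1,\ldots,N$ increasing along rows from left to right and along columns from top to bottom. An integer $k$ is a braid hook of $t$ if there is a cell $(r,c)$ such that $t$ contains $k-1$ in cell $(r,c)$, $k$ in cell $(r,c+1)$, $k+1$ in cell $(r+1,c+1)$, and the cell $(r+1,c)$ does not belong to the diagram. *)

(* Defs.v *)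
From mathcomp Require Import all_boot.
From mathcomp Require Import finmap.

Set Implicit Arguments.
Unset Strict Implicit.
Unset Printing Implicit Defensive.

Local Open Scope fset_scope.

(* A cell is a pair (r, c): row r counted from top to bottom, column c counted
   from left to right, both starting at 1. *)
Definition cell : Type := (nat * nat)%type.

Definition shifted_trapezoid (n : nat) : {fset cell} :=
  [fset x : cell in allpairs pair (iota 1 n.+1) (iota 1 (2 * n + 1))
     | x.1 <= x.2 <= 2 * n + 2 - x.1].

Lemma mem_shifted_trapezoid (n r c : nat) :
  ((r, c) \in shifted_trapezoid n)
  = (1 <= r <= n.+1) && (r <= c <= 2 * n + 2 - r).
Proof.
have inbox : ((r, c) \in allpairs pair (iota 1 n.+1) (iota 1 (2 * n + 1)))
             = (1 <= r <= n.+1) && (1 <= c <= 2 * n + 1).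
  apply/allpairsP/andP.
    by case=> [[a b]] [] /[!mem_iota] /[!add1n] /[!ltnS] /= ha hb [-> ->].
  by case=> hr hc; exists (r, c); rewrite !mem_iota !add1n !ltnS.
rewrite /shifted_trapezoid !inE.
transitivity ((1 <= r <= n.+1) && (1 <= c <= 2 * n + 1)
              && (r <= c <= 2 * n + 2 - r)); first by rewrite -inbox.
rewrite -andbA; case/boolP: (1 <= r <= n.+1) => //= /andP[r1 _].
apply: andb_idl => /andP[rc hc]; rewrite (leq_trans r1 rc) /=.
by rewrite (leq_trans hc) // leq_subLR addnCA leq_add2l (leq_add2r 1 1).
Qed.

Section Tableaux.
Variable D : {fset cell}.

(* Values lie in {0, ..., N-1}, where N is the number of cells of D; the
   integer written in a cell is the value plus one, see [entry]. *)
Definition filling : finType := {ffun D -> 'I_#|` D|}.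

Definition entry (t : filling) (x : D) : nat := (t x).+1.

Definition row_increasing (t : filling) : bool :=
  [forall x : D, forall y : D,
     ((val x).1 == (val y).1) && ((val x).2 < (val y).2)
     ==> (entry t x < entry t y)].

Definition col_increasing (t : filling) : bool :=
  [forall x : D, forall y : D,
     ((val x).2 == (val y).2) && ((val x).1 < (val y).1)
     ==> (entry t x < entry t y)].

Definition bijective_filling (t : filling) : bool :=
  injectiveb t && [forall k : 'I_#|` D|, exists x : D, t x == k].

Definition standard_tableaux : {set filling} :=
  [set t : filling |
     [&& bijective_filling t, row_increasing t & col_increasing t]].

Definition braid_hook (t : filling) (k : nat) : bool :=
  [exists x : D, exists y : D, exists z : D,
     let: (r, c) := val x in
     [&& val y == (r, c.+1), val z == (r.+1, c.+1), (r.+1, c) \notin D,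
         (entry t x).+1 == k, entry t y == k & entry t z == k.+1]].

Definition num_braid_hooks (t : filling) : nat :=
  count (braid_hook t) (iota 1 #|` D|).

End Tableaux.

(* Main.v *)
(* Give an adjacent pair of cells x, y the sign +1 if y lies to the right of x
   and -1 if y lies below x. Sum sign(a, b) - sign(b, c) over all standard
   tableaux and all triples of cells a, b, c carrying consecutive labels. For
   each tableau the sum telescopes to the sign of the first two cells minus the
   sign of the last two. On the other hand, exchanging the labels of two
   consecutive incomparable cells is an involution on tableaux-with-a-marked-
   pair, and it cancels every triple except the chains that turn from
   horizontal to vertical, which are the braid hooks and contribute 2 each. In
   the trapezoid the labels 1 and 2 are always in (1,1) and (1,2), while the two
   largest labels are never in adjacent cells, so twice the number of braid
   hooks is the number of tableaux. *)
Require Import Defs.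
From mathcomp Require Import all_boot all_order all_algebra.
From mathcomp Require Import finmap.
From mathcomp Require Import perm.
From mathcomp Require Import zify ring lra.

Import GRing.Theory.
Local Open Scope ring_scope.

(** * Standard tableaux and the exchange of two consecutive labels *)

Section StandardTableaux.
Set Implicit Arguments.
Unset Strict Implicit.
Context (D : {fset cell}).
Implicit Types (t : filling D) (a b c x y z : D).

(* Cells with consecutive labels are comparable exactly when they are aligned. *)
Definition aligned x y : bool :=
  ((val x).1 == (val y).1) || ((val x).2 == (val y).2).

(** Exactly the inequalities imposed by rows and columns. This relation is not transitive; passing
    to the order it generates needs a corner cell. *)
Definition line_lt x y : bool :=
  (((val x).1 == (val y).1) && ((val x).2 < (val y).2)%N)
  || (((val x).2 == (val y).2) && ((val x).1 < (val y).1)%N).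

Definition right_of x y : bool := val y == ((val x).1, (val x).2.+1).

Definition below x y : bool := val y == ((val x).1.+1, (val x).2).

Definition next t x y : bool := (t x).+1 == t y.

Lemma standardP t :
  reflect (injective t /\ forall x y, line_lt x y -> (t x < t y)%N)
          (t \in standard_tableaux D).
Proof.
rewrite inE; apply: (iffP and3P).
  case=> /andP[/injectiveP tI _] /forallP tr /forallP tc; split=> // x y.
  case/orP=> h.
    by have /forallP/(_ y)/implyP/(_ h) := tr x; rewrite ltnS.
  by have /forallP/(_ y)/implyP/(_ h) := tc x; rewrite ltnS.
case=> tI tl; split.
- apply/andP; split; first exact/injectiveP.
  apply/forallP=> k; have cD : #|'I_#|` D| | = #|{: D}| by rewrite card_ord cardfE.
  have /codomP[x ->] : k \in codom t by rewrite inj_card_onto // cD.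
  by apply/existsP; exists x.
- apply/forallP=> x; apply/forallP=> y; apply/implyP=> h.
  by rewrite ltnS tl // /line_lt h.
- apply/forallP=> x; apply/forallP=> y; apply/implyP=> h.
  by rewrite ltnS tl // /line_lt h orbT.
Qed.

Lemma standard_onto t (k : nat) :
  t \in standard_tableaux D -> (k < #|` D|)%N -> exists x, t x = k :> nat.
Proof.
rewrite inE => /and3P[/andP[_ /forallP h] _ _] kD.
by have /existsP[x /eqP tx] := h (Ordinal kD); exists x; rewrite tx.
Qed.

Lemma standard_inj t x y :
  t \in standard_tableaux D -> t x = t y :> nat -> x = y.
Proof. by move=> /standardP[tI _] h; apply: tI; apply: val_inj. Qed.

Lemma alignedC x y : aligned x y = aligned y x.
Proof. by rewrite /aligned ![(_ == (val y).1)]eq_sym ![(_ == (val y).2)]eq_sym. Qed.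

Lemma aligned_next_lt t x y :
  t \in standard_tableaux D -> next t x y -> aligned x y -> line_lt x y.
Proof.
move=> st /eqP xy al; have /standardP[_ tl] := st.
have nyx : ~~ line_lt y x by apply/negP => /tl; lia.
have : val x != val y by apply/eqP => /val_inj e; move: xy; rewrite e; lia.
move: al nyx; rewrite /aligned /line_lt.
case: (val x) (val y) => [r s] [r' s'] /=; rewrite xpair_eqE; lia.
Qed.

Definition swap_labels x y t : filling D := [ffun z => t (tperm x y z)].

Lemma swap_labelsK x y : involutive (swap_labels x y).
Proof. by move=> t; apply/ffunP=> z; rewrite !ffunE tpermK. Qed.

Lemma swap_labelsC x y : swap_labels x y =1 swap_labels y x.
Proof. by move=> t; apply/ffunP=> z; rewrite !ffunE tpermC. Qed.

(** No label lies strictly between two consecutive ones, so the exchange reverses the order of the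
    pair [x], [y] only, and no row or column condition relates two unaligned cells. *)
Lemma swap_labels_standard x y t :
  t \in standard_tableaux D -> next t x y -> ~~ aligned x y ->
  swap_labels x y t \in standard_tableaux D.
Proof.
move=> st /eqP xy nal; have /standardP[tI tl] := st.
apply/standardP; split=> [u v|u v uv].
  by rewrite !ffunE => /tI /perm_inj.
have tuv := tl _ _ uv; rewrite !ffunE.
have al : aligned u v.
  by move: uv; rewrite /aligned /line_lt => /orP[] /andP[-> _] //; rewrite orbT.
have E (p q : D) : p <> q -> t p <> t q :> nat.
  by move=> pq /(@standard_inj t p q st).
case: tpermP => [eu|eu|/E nux /E nuy]; case: tpermP => [ev|ev|/E nvx /E nvy];
  subst; lia.
Qed.

(** * Weighted sums over triples of cells with consecutive labels *)

Definition consecutive t a b c : bool :=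
  [&& t \in standard_tableaux D, next t a b & next t b c].

Definition count3 a b c : rat := \sum_t (consecutive t a b c)%:R.

(** Weights depend on the cells alone, so the tableaux enter only through [count3], and the exchange
    involution becomes a partial symmetry of these coefficients. *)
Definition sum3 (f : D -> D -> D -> rat) : rat :=
  \sum_a \sum_b \sum_c count3 a b c * f a b c.

Lemma consecutive_swap23 t a b c :
  ~~ aligned b c -> consecutive t a b c ->
  consecutive (swap_labels b c t) a c b.
Proof.
move=> nal /and3P[st ab bc]; apply/and3P.
rewrite swap_labels_standard // /next !ffunE tpermL tpermR.
move: (ab) (bc) => /eqP ab' /eqP bc'.
rewrite tpermD ?(eq_sym c) ?(eq_sym b) //; try by apply/eqP => e; subst; lia.
Qed.

Lemma consecutive_swap12 t a b c :
  ~~ aligned a b -> consecutive t a b c ->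
  consecutive (swap_labels a b t) b a c.
Proof.
move=> nal /and3P[st ab bc]; apply/and3P.
rewrite swap_labels_standard // /next !ffunE tpermL tpermR.
move: (ab) (bc) => /eqP ab' /eqP bc'.
rewrite tpermD ?(eq_sym c) ?(eq_sym b) //; try by apply/eqP => e; subst; lia.
Qed.

Lemma count3_swap23 a b c : ~~ aligned b c -> count3 a b c = count3 a c b.
Proof.
move=> nal; have nal' : ~~ aligned c b by rewrite alignedC.
rewrite /count3 (reindex_inj (inv_inj (swap_labelsK b c))).
apply: eq_bigr => t _; congr (_%:R); congr nat_of_bool; apply/idP/idP => h.
  by rewrite -[t](swap_labelsK b c); apply: consecutive_swap23.
by rewrite swap_labelsC; apply: consecutive_swap23.
Qed.

Lemma count3_swap12 a b c : ~~ aligned a b -> count3 a b c = count3 b a c.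
Proof.
move=> nal; have nal' : ~~ aligned b a by rewrite alignedC.
rewrite /count3 (reindex_inj (inv_inj (swap_labelsK a b))).
apply: eq_bigr => t _; congr (_%:R); congr nat_of_bool; apply/idP/idP => h.
  by rewrite -[t](swap_labelsK a b); apply: consecutive_swap12.
by rewrite swap_labelsC; apply: consecutive_swap12.
Qed.

(** [count3] is symmetric in [b] and [c] only when they are unaligned; the vanishing of [f] removes
    all other terms. *)
Lemma sum3_swap23 f :
  (forall a b c, aligned b c -> f a b c = 0) ->
  sum3 f = sum3 (fun a b c => f a c b).
Proof.
move=> f0; apply: eq_bigr => a _; rewrite exchange_big; apply: eq_bigr => c _.
apply: eq_bigr => b _; case: (boolP (aligned b c)) => bc.
  by rewrite f0 // !mulr0.
by rewrite count3_swap23.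
Qed.

Lemma sum3_swap12 f :
  (forall a b c, aligned a b -> f a b c = 0) ->
  sum3 f = sum3 (fun a b c => f b a c).
Proof.
move=> f0; rewrite /sum3 exchange_big; apply: eq_bigr => b _.
apply: eq_bigr => a _; apply: eq_bigr => c _; case: (boolP (aligned a b)) => ab.
  by rewrite f0 // !mulr0.
by rewrite count3_swap12.
Qed.

(** Weights need to agree only on triples realised by some tableau. This is how local geometric
    facts enter the sums. *)
Lemma eq_sum3 f g :
  (forall t a b c, consecutive t a b c -> f a b c = g a b c) -> sum3 f = sum3 g.
Proof.
move=> fg; apply: eq_bigr => a _; apply: eq_bigr => b _; apply: eq_bigr => c _.
rewrite /count3 !mulr_suml; apply: eq_bigr => t _.
by case: (boolP (consecutive t a b c)) => [/fg->|_] //; rewrite !mul0r.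
Qed.

Lemma sum3D f g : sum3 (fun a b c => f a b c + g a b c) = sum3 f + sum3 g.
Proof.
rewrite /sum3 -big_split; apply: eq_bigr => a _; rewrite -big_split.
apply: eq_bigr => b _; rewrite -big_split; apply: eq_bigr => c _ /=.
by rewrite mulrDr.
Qed.

Lemma sum3Z k f : sum3 (fun a b c => k * f a b c) = k * sum3 f.
Proof.
rewrite /sum3 mulr_sumr; apply: eq_bigr => a _; rewrite mulr_sumr.
apply: eq_bigr => b _; rewrite mulr_sumr; apply: eq_bigr => c _ /=.
by rewrite mulrCA.
Qed.

Lemma sum30 : sum3 (fun _ _ _ => 0) = 0.
Proof.
by rewrite /sum3 big1 // => a _; rewrite big1 // => b _; rewrite big1 // => c _;
  rewrite mulr0.
Qed.

(** * Signs of adjacent pairs and the telescoping sum *)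

Definition edge_sign x y : rat := (right_of x y)%:R - (below x y)%:R.

Definition count_first x y : rat :=
  \sum_t [&& t \in standard_tableaux D, next t x y & t x == 0%N :> nat]%:R.

(** Labels start at 0, so the largest one is the number of cells minus one. *)
Definition count_last x y : rat :=
  \sum_t [&& t \in standard_tableaux D, next t x y & (t y).+1 == #|` D|]%:R.

Lemma edge_sign_aligned x y : ~~ aligned x y -> edge_sign x y = 0.
Proof.
rewrite /edge_sign /aligned /right_of /below.
case: (val x) (val y) => [r s] [r' s'] /=; rewrite !xpair_eqE => h.
have -> : (r' == r) && (s' == s.+1) = false by lia.
have -> : (r' == r.+1) && (s' == s) = false by lia.
by rewrite subrr.
Qed.

Lemma sum_label t (k : nat) :
  t \in standard_tableaux D ->
  \sum_x (t x == k :> nat)%:R = (k < #|` D|)%:R :> rat.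
Proof.
move=> st; case: ltnP => kD.
  have [x0 tx0] := standard_onto st kD.
  rewrite (bigD1 x0) //= tx0 eqxx big1 ?addr0 // => x /eqP xx0.
  by case: eqP => // e; case: xx0; apply: (standard_inj st); rewrite e.
rewrite big1 // => x _; have := ltn_ord (t x); case: eqP => //; lia.
Qed.

(** A consecutive pair extends to a triple by exactly one cell, except when [y] already carries the
    largest label. *)
Lemma sum_count3_right x y :
  \sum_z count3 x y z
  = \sum_t [&& t \in standard_tableaux D & next t x y]%:R - count_last x y.
Proof.
rewrite /count3 exchange_big /= /count_last -sumrB; apply: eq_bigr => t _.
rewrite /consecutive; case: (boolP (t \in _)) => st /=; last first.
  by rewrite big1 // subrr.
case: (next t x y); last by rewrite big1 // subrr.
under eq_bigr => z _ do rewrite /= /next eq_sym.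
rewrite sum_label //; have tyN := ltn_ord (t y).
have -> : ((t y).+1 == #|` D|) = ~~ ((t y).+1 < #|` D|)%N.
  by rewrite -leqNgt eqn_leq tyN.
by case: (_ < _)%N; rewrite /= ?subr0 ?subrr.
Qed.

Lemma sum_count3_left x y :
  \sum_z count3 z x y
  = \sum_t [&& t \in standard_tableaux D & next t x y]%:R - count_first x y.
Proof.
rewrite /count3 exchange_big /= /count_first -sumrB; apply: eq_bigr => t _.
rewrite /consecutive; case: (boolP (t \in _)) => st /=; last first.
  by rewrite big1 // subrr.
case: (next t x y); last by rewrite big1 ?subrr // => z _; rewrite andbF.
under eq_bigr => z _ do rewrite andbT /next.
case: (posnP (t x)) => [->|tx] /=; first by rewrite big1 // subrr.
under eq_bigr => z _.
  have -> : ((t z).+1 == t x :> nat) = (t z == (t x).-1 :> nat) by lia.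
  over.
rewrite sum_label // (leq_ltn_trans (leq_pred _) (ltn_ord _)).
by rewrite subr0.
Qed.

Lemma telescope_edge_sign :
  sum3 (fun a b c => edge_sign a b - edge_sign b c)
  = \sum_x \sum_y (count_first x y - count_last x y) * edge_sign x y.
Proof.
transitivity (sum3 (fun a b _ => edge_sign a b)
              + -1 * sum3 (fun _ b c => edge_sign b c)).
  by rewrite -sum3Z -sum3D; apply: eq_sum3 => *; rewrite mulN1r.
have -> : sum3 (fun _ b c => edge_sign b c)
    = \sum_x \sum_y (\sum_z count3 z x y) * edge_sign x y.
  rewrite /sum3 exchange_big; apply: eq_bigr => x _.
  rewrite exchange_big; apply: eq_bigr => y _.
  by rewrite mulr_suml.
rewrite mulN1r /sum3 -sumrB; apply: eq_bigr => x _.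
rewrite -sumrB; apply: eq_bigr => y _.
by rewrite -mulr_suml sum_count3_right sum_count3_left; ring.
Qed.

(** * Local geometry of consecutive triples in a convex diagram *)

Context (row_convex : forall (r c s d : nat),
  (r, c) \in D -> (r, d) \in D -> (c <= s <= d)%N -> (r, s) \in D).
Context (col_convex : forall (r s q c : nat),
  (r, c) \in D -> (q, c) \in D -> (r <= s <= q)%N -> (s, c) \in D).
(** Only the upper right corner of a rectangle is required. The lower left one may be absent, which
    is what makes room for braid hooks. *)
Context (corner_closed : forall (r c r' c' : nat),
  (r, c) \in D -> (r', c') \in D -> (r <= r')%N -> (c <= c')%N ->
  (r, c') \in D).

Lemma next_no_between t x y z :
  t \in standard_tableaux D -> next t x y -> line_lt x z -> line_lt z y -> False.
Proof. by move=> /standardP[_ tl] /eqP xy /tl xz /tl zy; lia. Qed.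

(** By convexity, aligned cells that are not adjacent have a diagram cell between them, whose label
    would fall strictly between two consecutive integers. *)
Lemma next_cover t x y :
  t \in standard_tableaux D -> next t x y -> aligned x y ->
  right_of x y || below x y.
Proof.
move=> st xy /(aligned_next_lt st xy).
have mid z := @next_no_between t x y z st xy.
move: (valP x) (valP y); rewrite /line_lt /right_of /below.
case ex: (val x) => [r c]; case ey: (val y) => [r' c'] /= xD yD.
rewrite !xpair_eqE; case/orP=> /andP[/eqP e lt]; subst r' || subst c'.
- have [|ne] := eqVneq c' c.+1; first by rewrite eqxx.
  have zD : (r, c.+1) \in D by apply: (row_convex xD yD); lia.
  by case: (mid [` zD]%fset); rewrite /line_lt ?ex ?ey /=; lia.
- have [|ne] := eqVneq r' r.+1; first by rewrite eqxx orbT.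
  have zD : (r.+1, c) \in D by apply: (col_convex xD yD); lia.
  by case: (mid [` zD]%fset); rewrite /line_lt ?ex ?ey /=; lia.
Qed.

Lemma consecutive_between t a b c x :
  consecutive t a b c -> line_lt a x -> line_lt x c -> x = b.
Proof.
case/and3P=> st /eqP ab /eqP bc; have /standardP[_ tl] := st.
by move=> /tl ax /tl xc; apply: (standard_inj st); lia.
Qed.

(** The upper right corner of the turn belongs to the diagram and lies between [a] and [c], so it
    would have to carry the label of [b]. *)
Lemma not_below_right t a b c :
  consecutive t a b c -> below a b -> right_of b c -> False.
Proof.
move=> abc; rewrite /right_of /below; case ea: (val a) => [r s] /= /eqP eb.
rewrite eb /= => /eqP ec.
have zD : (r, s.+1) \in D.
  by apply: (@corner_closed r s r.+1 s.+1); rewrite // -?ea -?ec ?(valP a) ?(valP c).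
have : [` zD]%fset = b.
  by apply: (consecutive_between abc); rewrite /line_lt ?ea /= ?ec /=; lia.
by move/(congr1 val) => /=; rewrite eb => -[]; lia.
Qed.

(** After exchanging [b] and [c], the cell [c] directly follows [a]. Hence both are adjacent to [a],
    and being unaligned they lie one to its right and one below it. *)
Lemma edge_sign_fork t a b c :
  consecutive t a b c -> ~~ aligned b c -> aligned a b -> aligned a c ->
  edge_sign a b + edge_sign a c = 0.
Proof.
move=> abc nbc ab ac; have /and3P[st nab _] := abc.
have /and3P[st' nac _] := consecutive_swap23 nbc abc.
have := next_cover st' nac ac; have := next_cover st nab ab.
move: nbc; rewrite /edge_sign /aligned /right_of /below.
case: (val a) (val b) (val c) => [r s] [r1 s1] [r2 s2] /=.
rewrite !xpair_eqE !negb_or => /andP[/eqP h1 /eqP h2].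
by case/orP => /andP[/eqP e1 /eqP e2]; case/orP => /andP[/eqP e3 /eqP e4];
  subst; do ?[case: eqP => ? //=; try lia]; lra.
Qed.

Lemma edge_sign_cofork t a b c :
  consecutive t a b c -> ~~ aligned a b -> aligned a c -> aligned b c ->
  edge_sign b c + edge_sign a c = 0.
Proof.
move=> abc nab ac bc; have /and3P[st _ nbc] := abc.
have /and3P[st' _ nac] := consecutive_swap12 nab abc.
have := next_cover st' nac ac; have := next_cover st nbc bc.
move: nab; rewrite /edge_sign /aligned /right_of /below.
case: (val a) (val b) (val c) => [r s] [r1 s1] [r2 s2] /=.
rewrite !xpair_eqE !negb_or => /andP[/eqP h1 /eqP h2].
by case/orP => /andP[/eqP e1 /eqP e2]; case/orP => /andP[/eqP e3 /eqP e4];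
  subst; do ?[case: eqP => ? //=; try lia]; lra.
Qed.

(** When both pairs are aligned, straight chains give 0, right-then-below gives 1 - (-1) = 2, and
    below-then-right cannot occur. Unaligned pairs have sign 0, which leaves the two correction
    terms. *)
Lemma edge_sign_diff t a b c :
  consecutive t a b c ->
  edge_sign a b - edge_sign b c
  = 2%:R * (right_of a b && below b c)%:R
    + ((~~ aligned b c)%:R * edge_sign a b
       + -1 * ((~~ aligned a b)%:R * edge_sign b c)).
Proof.
move=> abc; have /and3P[st nab nbc] := abc.
have nvh := @not_below_right _ _ _ _ abc.
case: (boolP (aligned b c)) => bc; last first.
  have -> : below b c = false.
    by apply/negP => /eqP e; move: bc; rewrite /aligned e eqxx orbT.
  by rewrite (edge_sign_aligned bc) andbF /=; ring.
case: (boolP (aligned a b)) => ab; last first.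
  have -> : right_of a b = false.
    by apply/negP => /eqP e; move: ab; rewrite /aligned e eqxx.
  by rewrite (edge_sign_aligned ab) /=; ring.
have := next_cover st nab ab; have := next_cover st nbc bc.
have excl x y : ~~ (right_of x y && below x y).
  apply/negP; rewrite /right_of /below => /andP[/eqP -> ].
  by rewrite xpair_eqE; lia.
have := excl a b; have := excl b c; rewrite /edge_sign; move: nvh.
case: (right_of a b) (right_of b c) (below a b) (below b c)
  => [] [] [] [] //= nvh _ _ _ _; try (by case: nvh); lra.
Qed.

Lemma sum3_unaligned :
  sum3 (fun a b c => (~~ aligned b c)%:R * edge_sign a b)
  = sum3 (fun a b c => (~~ aligned a b)%:R * edge_sign b c).
Proof.
(* X1 and Y1 vanish because a cell's two neighbours in a fork (or cofork) have
   opposite signs; X2 and Y2 agree after moving the isolated cell across the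
   other two. *)
pose X1 := sum3 (fun a b c =>
  (~~ aligned b c)%:R * ((aligned a c)%:R * edge_sign a b)).
pose X2 := sum3 (fun a b c =>
  (~~ aligned b c)%:R * ((~~ aligned a c)%:R * edge_sign a b)).
pose Y1 := sum3 (fun a b c =>
  (~~ aligned a b)%:R * ((aligned a c)%:R * edge_sign b c)).
pose Y2 := sum3 (fun a b c =>
  (~~ aligned a b)%:R * ((~~ aligned a c)%:R * edge_sign b c)).
transitivity (X1 + X2).
  rewrite /X1 /X2 -sum3D; apply: eq_sum3 => t a b c _.
  by case: (aligned a c) => /=; ring.
transitivity (Y1 + Y2); last first.
  rewrite /Y1 /Y2 -sum3D; apply: eq_sum3 => t a b c _.
  by case: (aligned a c) => /=; ring.
have X10 : X1 = 0.
  suff : X1 + X1 = 0 by lra.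
  rewrite {2}/X1 sum3_swap23; last by move=> a b c ->; rewrite mul0r.
  rewrite -sum3D -[RHS]sum30; apply: eq_sum3 => t a b c abc.
  rewrite (alignedC c b); case: (boolP (aligned b c)) => bc /=; first by ring.
  case: (boolP (aligned a c)) => ac; case: (boolP (aligned a b)) => ab /=.
  - by rewrite !mul1r (edge_sign_fork abc).
  - by rewrite (edge_sign_aligned ab); ring.
  - by rewrite (edge_sign_aligned ac); ring.
  - by ring.
have Y10 : Y1 = 0.
  suff : Y1 + Y1 = 0 by lra.
  rewrite {2}/Y1 sum3_swap12; last by move=> a b c ->; rewrite mul0r.
  rewrite -sum3D -[RHS]sum30; apply: eq_sum3 => t a b c abc.
  rewrite (alignedC b a); case: (boolP (aligned a b)) => ab /=; first by ring.
  case: (boolP (aligned a c)) => ac; case: (boolP (aligned b c)) => bc /=.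
  - by rewrite !mul1r (edge_sign_cofork abc).
  - by rewrite (edge_sign_aligned bc); ring.
  - by rewrite (edge_sign_aligned ac); ring.
  - by ring.
rewrite X10 Y10 !add0r /X2 /Y2 sum3_swap23; last by move=> a b c ->; rewrite mul0r.
rewrite sum3_swap12; last by move=> a b c ->; rewrite mul0r mulr0.
apply: eq_sum3 => t a b c _.
by rewrite (alignedC c a) (alignedC b a) mulrCA.
Qed.

(** * Braid hooks as triples, and the boundary formula *)

Lemma braid_hook_sum t (k : nat) : t \in standard_tableaux D ->
  braid_hook t k
  = (\sum_(u : D * D * D) [&& next t u.1.1 u.1.2, next t u.1.2 u.2,
       right_of u.1.1 u.1.2, below u.1.2 u.2 & (t u.1.2).+1 == k])%N :> nat.
Proof.
(* The missing lower left cell in the definition of a braid hook is automatic: if present, it would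
   lie between [a] and [c] and so coincide with [b]. *)
move=> st; have abcP (a b c : D) : next t a b -> next t b c ->
    right_of a b -> below b c -> ((val a).1.+1, (val a).2) \notin D.
  move=> ab bc rab bbc; apply/negP => zD.
  have abc : consecutive t a b c by rewrite /consecutive st ab.
  move: rab bbc; rewrite /right_of /below => /eqP eb; rewrite eb => /eqP ec.
  have : [` zD]%fset = b.
    by apply: (consecutive_between abc); rewrite /line_lt ?ec /=; lia.
  by move/(congr1 val) => /=; rewrite eb => -[]; lia.
case: (boolP (braid_hook t k)) => [h|h].
  have [a [b [c [ab bc rab bbc bk]]]] : exists a b c,
      [/\ next t a b, next t b c, right_of a b, below b c & (t b).+1 == k].
    move: h => /existsP[a /existsP[b /existsP[c]]].
    rewrite /entry; case ea: (val a) => [r s].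
    case/and5P=> eb ec _ ak /andP[bk ck]; exists a, b, c; split=> //.
    - by rewrite /next; move: ak bk; lia.
    - by rewrite /next; move: ck bk; lia.
    - by rewrite /right_of ea.
    - by rewrite /below (eqP eb).
  (* The value [k] fixes the label of the middle cell, hence all three cells, so the sum has a
     single nonzero term. *)
  rewrite (bigD1 (a, b, c)) //= ab bc rab bbc bk big1 // => -[[a' b'] c'] /= ne.
  apply/eqP; rewrite eqb0; apply/negP => /and5P[ab' bc' _ _ bk'].
  have eb : b' = b.
    by apply: (standard_inj st); apply: succn_inj; rewrite (eqP bk) (eqP bk').
  subst b'; have ea : a' = a.
    by apply: (standard_inj st); apply: succn_inj; rewrite (eqP ab) (eqP ab').
  have ec : c' = c by apply: (standard_inj st); rewrite -(eqP bc) -(eqP bc').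
  by rewrite ea ec eqxx in ne.
rewrite big1 // => -[[a b] c] _ /=; apply/eqP; rewrite eqb0.
apply: contra h => /and5P[ab bc rab bbc bk].
apply/existsP; exists a; apply/existsP; exists b; apply/existsP; exists c.
have := abcP _ _ _ ab bc rab bbc.
move: rab bbc ab bc; rewrite /right_of /below /next /entry bk.
case: (val a) => [r s] /= eb; rewrite (eqP eb) /= => -> ab bc ->.
by rewrite eqxx /= (eqP ab) -(eqP bc) bk.
Qed.

Lemma sum_num_braid_hooks :
  sum3 (fun a b c => (right_of a b && below b c)%:R)
  = \sum_(t in standard_tableaux D) (num_braid_hooks t)%:R.
Proof.
rewrite [RHS]big_mkcond /=.
transitivity (\sum_(u : D * D * D) \sum_t
  [&& consecutive t u.1.1 u.1.2 u.2, right_of u.1.1 u.1.2 & below u.1.2 u.2]%:R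
  : rat).
  rewrite /sum3 pair_bigA pair_bigA; apply: eq_bigr => u _ /=.
  rewrite /count3 mulr_suml; apply: eq_bigr => t _.
  by rewrite -natrM mulnb.
rewrite exchange_big; apply: eq_bigr => t _; case: ifPn => st; last first.
  by rewrite big1 // => u _; rewrite /consecutive (negPf st).
rewrite -natr_sum; congr (_%:R).
have -> : num_braid_hooks t = (\sum_(k <- iota 1 #|` D|) braid_hook t k)%N.
  by rewrite /num_braid_hooks -sum1_count big_mkcond.
rewrite (eq_bigr _ (fun k _ => @braid_hook_sum t k st)).
rewrite exchange_big; apply: eq_bigr => -[[a b] c] _ /=.
rewrite /consecutive st.
case: (next t a b) (next t b c) (right_of a b) (below b c) => [] [] [] [] /=;
  try by rewrite big1.
(* Each triple is counted for one [k] only, the entry of its middle cell, which is its label plus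
   one. *)
rewrite (bigD1_seq (t b).+1) ?iota_uniq //=; last first.
  by rewrite mem_iota add1n !ltnS ltn_ord.
by rewrite eqxx big1 // => k /negPf; rewrite eq_sym => ->.
Qed.

Lemma braid_hooks_boundary :
  2%:R * \sum_(t in standard_tableaux D) (num_braid_hooks t)%:R
  = \sum_x \sum_y (count_first x y - count_last x y) * edge_sign x y.
Proof.
rewrite -sum_num_braid_hooks -telescope_edge_sign.
by rewrite (eq_sum3 edge_sign_diff) !sum3D !sum3Z sum3_unaligned; ring.
Qed.

(** For unaligned cells the inequality passes through the upper right corner, which shares a row
    with [x] and a column with [y]. *)
Lemma standard_lt t x y :
  t \in standard_tableaux D -> x != y ->
  ((val x).1 <= (val y).1)%N -> ((val x).2 <= (val y).2)%N -> (t x < t y)%N.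
Proof.
move=> st xy; have /standardP[_ tl] := st; have : val x != val y := xy.
move: (valP x) (valP y) (tl x y); rewrite /line_lt.
case ex: (val x) => [r s]; case ey: (val y) => [r' s'] /= xD yD tlxy.
rewrite xpair_eqE => ne rr ss.
have [rs|] := boolP ((r == r') || (s == s')); first by apply: tlxy; lia.
move=> nrs; have zD := corner_closed xD yD rr ss.
by apply: (@ltn_trans (t [` zD]%fset)); apply: tl;
  rewrite /line_lt ?ex ?ey /=; lia.
Qed.

End StandardTableaux.

(* The row reading tableau; needed because 0 / 0 = 0 in [rat]. *)
Lemma standard_tableau_exists (D : {fset cell}) :
  exists t, t \in standard_tableaux D.
Proof.
pose lexn (p q : nat * nat) := (p.1 < q.1)%N || (p.1 == q.1) && (p.2 < q.2)%N.
have lexn_irr p : lexn p p = false by rewrite /lexn; lia.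
have lexn_trans p q r : lexn p q -> lexn r p -> lexn r q by rewrite /lexn; lia.
have lexn_total p q : ~~ lexn p q -> ~~ lexn q p -> p = q.
  case: p q => [a b] [c d]; rewrite /lexn /= => h1 h2.
  by apply/eqP; rewrite xpair_eqE; lia.
have lexn_line (x y : D) : line_lt x y -> lexn (val x) (val y).
  rewrite /line_lt; case: (val x) (val y) => [a b] [c d] /=.
  by rewrite /lexn /= => /orP[/andP[-> ->]|/andP[_ ->]] //; rewrite orbT.
pose lex (y x : D) := lexn (val y) (val x).
pose rank (x : D) := #|[set y | lex y x]|.
have rankD (x : D) : (rank x < #|` D|)%N.
  rewrite cardfE -cardsT; apply: proper_card.
  rewrite properEneq subsetT andbT.
  by apply/eqP => /setP/(_ x); rewrite !inE /lex lexn_irr.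
have rank_lt (x y : D) : lex x y -> (rank x < rank y)%N.
  move=> xy; apply: proper_card; apply/properP; split.
    by apply/subsetP => z; rewrite !inE; exact: lexn_trans xy.
  by exists x; rewrite !inE // /lex lexn_irr.
exists [ffun x => Ordinal (rankD x)]; apply/standardP; split=> [x y|x y xy].
  rewrite !ffunE => /(congr1 val) /= e; apply: val_inj.
  have nxy : ~~ lex x y by apply/negP => /rank_lt; rewrite e ltnn.
  have nyx : ~~ lex y x by apply/negP => /rank_lt; rewrite e ltnn.
  exact: lexn_total.
by rewrite !ffunE /= rank_lt //; apply: lexn_line.
Qed.

(** * The first two and last two labels in the trapezoid *)

Section Trapezoid.
Context (n : nat) (n_gt0 : (0 < n)%N).
Let D := shifted_trapezoid n.
Implicit Types (t : filling D) (x y : D).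

Lemma trapezoid_row_convex (r c s d : nat) :
  (r, c) \in D -> (r, d) \in D -> (c <= s <= d)%N -> (r, s) \in D.
Proof. by rewrite !mem_shifted_trapezoid; lia. Qed.

Lemma trapezoid_col_convex (r s q c : nat) :
  (r, c) \in D -> (q, c) \in D -> (r <= s <= q)%N -> (s, c) \in D.
Proof. by rewrite !mem_shifted_trapezoid; lia. Qed.

Lemma trapezoid_corner_closed (r c r' c' : nat) :
  (r, c) \in D -> (r', c') \in D -> (r <= r')%N -> (c <= c')%N -> (r, c') \in D.
Proof. by rewrite !mem_shifted_trapezoid; lia. Qed.

Fact cell11_subproof : (1, 1)%N \in D.
Proof. by rewrite mem_shifted_trapezoid; lia. Qed.

Fact cell12_subproof : (1, 2)%N \in D.
Proof. by rewrite mem_shifted_trapezoid; lia. Qed.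

Definition cell11 : D := [` cell11_subproof]%fset.
Definition cell12 : D := [` cell12_subproof]%fset.

Lemma label_cell11 t : t \in standard_tableaux D -> t cell11 = 0%N :> nat.
Proof.
move=> st; have [x tx] := standard_onto st (leq_ltn_trans (leq0n _) (ltn_ord (t cell11))).
have [->//|ne] := eqVneq cell11 x.
have : (t cell11 < t x)%N.
  apply: (standard_lt trapezoid_corner_closed st ne); have := valP x;
    by case: (val x) => [r s] /=; rewrite mem_shifted_trapezoid; lia.
by rewrite tx.
Qed.

(** Since [r <= c], the first column is just (1,1), so every other cell is weakly below and to the
    right of (1,2). *)
Lemma label_cell12 t : t \in standard_tableaux D -> t cell12 = 1%N :> nat.
Proof.
move=> st; have t11 := label_cell11 st.
have t12 : (0 < t cell12)%N.
  by rewrite -t11; apply: (standard_lt trapezoid_corner_closed st).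
have [x tx] := standard_onto st (leq_ltn_trans t12 (ltn_ord (t cell12))).
have [->//|ne] := eqVneq cell12 x.
have x11 : val x != (1, 1)%N.
  by apply/eqP => e; move: tx; rewrite (_ : x = cell11) ?t11 //; apply: val_inj.
have : (t cell12 < t x)%N.
  apply: (standard_lt trapezoid_corner_closed st ne); move: x11 (valP x);
    by case: (val x) => [r s] /=; rewrite mem_shifted_trapezoid xpair_eqE; lia.
by rewrite tx ltnS leqNgt t12.
Qed.

Lemma trapezoid_count_first x y :
  count_first x y
  = ((x == cell11) && (y == cell12))%:R * #|standard_tableaux D|%:R.
Proof.
rewrite /count_first -sum1_card natr_sum mulr_sumr big_mkcond /=.
rewrite [RHS]big_mkcond; apply: eq_bigr => t _; case: ifP => st //=.
rewrite mulr1; congr (_%:R); congr nat_of_bool.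
have [t11 t12] := (label_cell11 st, label_cell12 st).
apply/andP/andP => [[/eqP txy /eqP tx]|[/eqP -> /eqP ->]].
  by split; apply/eqP; apply: (standard_inj st); rewrite ?t11 ?t12 // -txy tx.
by rewrite /next t11 t12.
Qed.

Lemma trapezoid_count_last x y : count_last x y * edge_sign x y = 0.
Proof.
have [xy|] := boolP (right_of x y || below x y); last first.
  by rewrite negb_or /edge_sign => /andP[/negPf-> /negPf->]; rewrite subrr mulr0.
rewrite /count_last big1 ?mul0r // => t _; apply/eqP.
rewrite Num.Theory.pnatr_eq0 eqb0; apply/negP => /and3P[st /eqP txy /eqP ty].
(* A third cell weakly below and to the right of [x] has a label above that of [x] and different
   from that of [y], hence above the largest label. *)
suff [z [xz yz zr zs]] : exists z, [/\ x != z, y != z,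
    ((val x).1 <= (val z).1)%N & ((val x).2 <= (val z).2)%N].
  have txz := standard_lt trapezoid_corner_closed st xz zr zs.
  have tyz : (t y < t z)%N.
    rewrite ltn_neqAle -{2}txy txz andbT.
    by apply: contra yz => /eqP /(standard_inj st) ->.
  by have := leq_ltn_trans tyz (ltn_ord (t z)); rewrite ty ltnn.
suff [[r s] zD] : exists2 z : cell, z \in D & [/\ val x != z, val y != z,
    ((val x).1 <= z.1)%N & ((val x).2 <= z.2)%N].
  by move=> [xz yz zr zs]; exists [` zD]%fset.
move: xy (valP x) (valP y); rewrite /right_of /below.
case: (val x) (val y) => [r s] [r' s'] /=; rewrite !xpair_eqE.
case/orP => /andP[/eqP -> /eqP ->] {r' s'}; rewrite !mem_shifted_trapezoid => h1 h2.
  (* For a horizontal pair the witness is the cell below [x], or the cell below [y] when [x] starts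
     its row. For a vertical pair it is the cell to the right of [x], present because the row below
     ends one column earlier. *)
  have [rs|rs] := boolP (r < s)%N.
    by exists (r.+1, s); rewrite ?mem_shifted_trapezoid ?xpair_eqE /=; [lia|split; lia].
  by exists (r.+1, s.+1); rewrite ?mem_shifted_trapezoid ?xpair_eqE /=; [lia|split; lia].
by exists (r, s.+1); rewrite ?mem_shifted_trapezoid ?xpair_eqE /=; [lia|split; lia].
Qed.

Lemma trapezoid_braid_hooks :
  2%:R * \sum_(t in standard_tableaux D) (num_braid_hooks t)%:R
  = #|standard_tableaux D|%:R :> rat.
Proof.
rewrite (braid_hooks_boundary trapezoid_row_convex trapezoid_col_convex
  trapezoid_corner_closed).
(* Only the pair (1,1), (1,2) survives, with sign +1. *)
have E x y : (count_first x y - count_last x y) * edge_sign x y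
    = if x == cell11 then if y == cell12 then #|standard_tableaux D|%:R else 0 else 0.
  rewrite mulrBl trapezoid_count_last subr0 trapezoid_count_first.
  case: eqP => [->|_]; last by rewrite !mul0r.
  case: eqP => [->|_]; last by rewrite !mul0r.
  by rewrite /edge_sign /right_of /below /= subr0 mulr1 mul1r.
under eq_bigr => x _ do under eq_bigr => y _ do rewrite E.
rewrite (bigD1 cell11) //= [X in _ + X]big1; last first.
  by move=> x /negPf ->; rewrite big1.
rewrite (bigD1 cell12) //= big1 ?addr0 //.
by move=> y /negPf ->.
Qed.

End Trapezoid.

Theorem theorem1p5 (n : nat) (hn : (1 <= n)%N) :
  (\sum_(t in standard_tableaux (shifted_trapezoid n))
     (num_braid_hooks t)%:R)
  / (#|standard_tableaux (shifted_trapezoid n)|)%:R = 1 / 2%:R :> rat.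
Proof.
have [t st] := standard_tableau_exists (shifted_trapezoid n).
have ST0 : #|standard_tableaux (shifted_trapezoid n)|%:R != 0 :> rat.
  by rewrite Num.Theory.pnatr_eq0 -lt0n; apply/card_gt0P; exists t.
have := @trapezoid_braid_hooks n hn.
move: (\sum_(t in _) _) => S H; rewrite -H in ST0 *.
by field; move: ST0; rewrite mulf_eq0 negb_or => /andP[_ ->].
Qed.
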